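(* Let $\alpha$ be a $\Sigma_2$-sentence such that $\alpha$ has a standard model and the only non-logical, non-arithmetical symbol that occurs in $\alpha$ is a unary relation symbol $P$. Then there is an arithmetically definable set $A\subseteq\mathbb{N}$ such that $(\mathbb{N},A)\models\alpha$ (with $P$ interpreted as $A$).
   Context: The arithmetical language $\mathcal{L}_A$ has signature $\langle 0,1,+,\times,<\rangle$ (with equality). In the language $\mathcal{L}_A\cup\{P\}$, $\Delta_0$ formulae are those built from atomic formulae (including those with $P$) by connectives and bounded quantifiers; $\Sigma_2$ formulae are of the form $\exists\bar x\forall\bar y\,\delta$ with $\delta\in\Delta_0$. $\alpha$ has a standard model if the standard model $\mathbb{N}$ of arithmetic can be expanded, by interpreting the additional symbols, to a model of $\alpha$. A set $A\subseteq\mathbb{N}$ is arithmetically definable if it is defined in $\mathbb{N}$ by an $\mathcal{L}_A$-formula. *)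

(* Defs.v *)
From Stdlib Require Import Arith.

Set Implicit Arguments.
Unset Strict Implicit.
Unset Printing Implicit Defensive.

(* First-order syntax, variables as de Bruijn indices. *)
Inductive term : Type :=
| tVar : nat -> term
| tZero : term
| tOne : term
| tAdd : term -> term -> term
| tMul : term -> term -> term.

(* [Sym] is the type of additional unary relation symbols: [formula Empty_set]
   is the set of formulas of L_A, [formula unit] that of L_A + {P}. *)
Inductive formula (Sym : Type) : Type :=
| fEq : term -> term -> formula Sym
| fLt : term -> term -> formula Sym
| fRel : Sym -> term -> formula Sym
| fNot : formula Sym -> formula Sym
| fAnd : formula Sym -> formula Sym -> formula Sym
| fOr : formula Sym -> formula Sym -> formula Sym
| fImp : formula Sym -> formula Sym -> formula Sym
| fAll : formula Sym -> formula Sym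
| fEx : formula Sym -> formula Sym.

Arguments fEq {Sym} _ _.
Arguments fLt {Sym} _ _.

Fixpoint term_below (n : nat) (t : term) : Prop :=
  match t with
  | tVar i => i < n
  | tZero => True
  | tOne => True
  | tAdd t u => term_below n t /\ term_below n u
  | tMul t u => term_below n t /\ term_below n u
  end.

(* All free variables of the formula have index [< n]. *)
Fixpoint formula_below (Sym : Type) (n : nat) (f : formula Sym) : Prop :=
  match f with
  | fEq t u => term_below n t /\ term_below n u
  | fLt t u => term_below n t /\ term_below n u
  | fRel _ t => term_below n t
  | fNot g => formula_below n g
  | fAnd g h => formula_below n g /\ formula_below n h
  | fOr g h => formula_below n g /\ formula_below n h
  | fImp g h => formula_below n g /\ formula_below n h
  | fAll g => formula_below (1 + n) g
  | fEx g => formula_below (1 + n) g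
  end.

Definition sentence (Sym : Type) (f : formula Sym) : Prop := formula_below 0 f.

Fixpoint shift (t : term) : term :=
  match t with
  | tVar i => tVar (1 + i)
  | tZero => tZero
  | tOne => tOne
  | tAdd t u => tAdd (shift t) (shift u)
  | tMul t u => tMul (shift t) (shift u)
  end.

(* In a bounded quantifier the bound must not contain the quantified variable,
   whence [shift t]. *)
Inductive Delta0 (Sym : Type) : formula Sym -> Prop :=
| D0_eq : forall t u, Delta0 (fEq t u)
| D0_lt : forall t u, Delta0 (fLt t u)
| D0_rel : forall s t, Delta0 (fRel s t)
| D0_not : forall f, Delta0 f -> Delta0 (fNot f)
| D0_and : forall f g, Delta0 f -> Delta0 g -> Delta0 (fAnd f g)
| D0_or : forall f g, Delta0 f -> Delta0 g -> Delta0 (fOr f g)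
| D0_imp : forall f g, Delta0 f -> Delta0 g -> Delta0 (fImp f g)
| D0_all : forall t f,
    Delta0 f -> Delta0 (fAll (fImp (fLt (tVar 0) (shift t)) f))
| D0_ex : forall t f,
    Delta0 f -> Delta0 (fEx (fAnd (fLt (tVar 0) (shift t)) f)).

(* Either block of quantifiers may be empty. *)
Definition Sigma2 (Sym : Type) (f : formula Sym) : Prop :=
  exists (m k : nat) (d : formula Sym),
    Delta0 d /\ f = Nat.iter m (@fEx Sym) (Nat.iter k (@fAll Sym) d).

Definition scons (a : nat) (e : nat -> nat) (i : nat) : nat :=
  match i with
  | 0 => a
  | S j => e j
  end.

Fixpoint eval (e : nat -> nat) (t : term) : nat :=
  match t with
  | tVar i => e i
  | tZero => 0
  | tOne => 1
  | tAdd t u => eval e t + eval e u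
  | tMul t u => eval e t * eval e u
  end.

(* Satisfaction in the expansion of the standard model by [I]. *)
Fixpoint sat (Sym : Type) (I : Sym -> nat -> Prop) (e : nat -> nat)
    (f : formula Sym) : Prop :=
  match f with
  | fEq t u => eval e t = eval e u
  | fLt t u => eval e t < eval e u
  | fRel s t => I s (eval e t)
  | fNot g => ~ sat I e g
  | fAnd g h => sat I e g /\ sat I e h
  | fOr g h => sat I e g \/ sat I e h
  | fImp g h => sat I e g -> sat I e h
  | fAll g => forall a : nat, sat I (scons a e) g
  | fEx g => exists a : nat, sat I (scons a e) g
  end.

Definition models (Sym : Type) (I : Sym -> nat -> Prop) (f : formula Sym) : Prop :=
  forall e : nat -> nat, sat I e f.

Definition has_standard_model (Sym : Type) (f : formula Sym) : Prop :=
  exists I : Sym -> nat -> Prop, models I f.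

Definition no_symbols (s : Empty_set) : nat -> Prop := match s with end.

Definition arith_definable (A : nat -> Prop) : Prop :=
  exists f : formula Empty_set,
    formula_below 1 f /\
    forall (n : nat) (e : nat -> nat), A n <-> sat no_symbols (scons n e) f.

(* Main.v *)
From Stdlib Require Import Arith Lia Classical FunctionalExtensionality.
Require Import Defs.

Set Implicit Arguments.
Unset Strict Implicit.
Unset Printing Implicit Defensive.

(** After fixing witnesses for the existential block, [alpha] becomes a [Pi1]
    condition [forall N, D(N)] on [P], with [D] a [Delta0] formula, hence one
    that depends on finitely many values of [P] for each [N].  So the sets
    satisfying it are the infinite branches of a binary tree.  The leftmost
    branch [A] is determined by: [i] is in [A] iff the string
    [A(0) ... A(i-1) 0] is not extendible, i.e. for some [N] no finite set
    continuing that string satisfies [D(N)].  Finite sets are coded by pairs of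
    numbers through divisibility, as with Goedel's beta function, so this
    recursion is expressible in [L_A]. *)

(** * Codes of finite sets *)

(** With [i + 1] in place of [i], the modulus exceeds 1 even at [i = 0] when [b > 0], so index 0 is
    not a member of every coded set. *)
Definition coded (a b i : nat) : Prop := Nat.divide (1 + (i + 1) * b) a.

Lemma divide_fact (n i : nat) : 0 < i <= n -> Nat.divide i (fact n).
Proof.
induction n as [|n IH]; [lia|]; intros Hi.
change (fact (S n)) with (S n * fact n).
destruct (Nat.eq_dec i (S n)) as [->|Hne].
- apply Nat.divide_factor_l.
- apply Nat.divide_mul_r, IH; lia.
Qed.

(** A common divisor [g] divides the difference [(j - i) * b] and is coprime to [b], hence divides
    [j - i < n]. Then it divides [b = n!] as well, so it is 1. *)
Lemma beta_moduli_coprime (n i j : nat) : i < j -> j < n ->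
  Nat.gcd (1 + (i + 1) * fact n) (1 + (j + 1) * fact n) = 1.
Proof.
intros Hij Hjn.
set (b := fact n); set (g := Nat.gcd _ _).
assert (Hi : Nat.divide g (1 + (i + 1) * b)) by apply Nat.gcd_divide_l.
assert (Hj : Nat.divide g (1 + (j + 1) * b)) by apply Nat.gcd_divide_r.
assert (Hdiff : Nat.divide g ((j - i) * b)).
{ replace ((j - i) * b) with (1 + (j + 1) * b - (1 + (i + 1) * b)) by nia.
  now apply Nat.divide_sub_r. }
assert (Hcop : Nat.gcd g b = 1).
{ apply Nat.divide_1_r.
  apply Nat.divide_add_cancel_r with ((i + 1) * b).
  - apply Nat.divide_mul_r, Nat.gcd_divide_r.
  - rewrite Nat.add_comm.
    apply Nat.divide_trans with g; [apply Nat.gcd_divide_l|exact Hi]. }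
assert (Hgb : Nat.divide g b).
{ apply Nat.divide_trans with (j - i).
  - rewrite Nat.mul_comm in Hdiff. now apply Nat.gauss with b.
  - apply divide_fact; lia. }
rewrite (proj1 (Nat.divide_gcd_iff _ _) Hgb) in Hcop. exact Hcop.
Qed.

Lemma coprime_mul (m a b : nat) :
  Nat.gcd m a = 1 -> Nat.gcd m b = 1 -> Nat.gcd m (a * b) = 1.
Proof.
intros Ha Hb. apply Nat.divide_1_r. rewrite <- Hb.
apply Nat.gcd_greatest; [apply Nat.gcd_divide_l|].
apply Nat.gauss with a; [apply Nat.gcd_divide_r|].
apply Nat.divide_1_r. rewrite <- Ha.
apply Nat.gcd_greatest; [|apply Nat.gcd_divide_r].
eapply Nat.divide_trans; apply Nat.gcd_divide_l.
Qed.

(** Take [b = n!] and let [a] be the product of the moduli of those [i < n] that lie in [S]. *)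
Lemma coded_finite (S : nat -> Prop) (n : nat) :
  exists a b, forall i, i < n -> (coded a b i <-> S i).
Proof.
set (m := fun i => 1 + (i + 1) * fact n).
assert (Hcop : forall i j, i < n -> j < n -> i <> j -> Nat.gcd (m i) (m j) = 1).
{ intros i j Hi Hj Hij.
  destruct (Nat.lt_total i j) as [H|[H|H]]; [|lia|rewrite Nat.gcd_comm];
    now apply beta_moduli_coprime. }
(* Induction over partial products: [a] stays coprime to the modulus of every index not yet
   multiplied in. *)
assert (Hprod : forall k, k <= n -> exists a,
  (forall i, i < k -> S i -> Nat.divide (m i) a) /\
  (forall j, j < n -> (j < k -> ~ S j) -> Nat.gcd (m j) a = 1)).
{ induction k as [|k IH]; intros Hk.
  - exists 1. split; [lia|]. intros. apply Nat.divide_1_r, Nat.gcd_divide_r.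
  - destruct IH as [a [Ha Ha']]; [lia|].
    destruct (classic (S k)) as [Sk|Sk].
    + exists (a * m k). split.
      * intros i Hi Si. destruct (Nat.eq_dec i k) as [->|Hne].
        -- apply Nat.divide_factor_r.
        -- apply Nat.divide_mul_l, Ha; [lia|exact Si].
      * intros j Hj Sj. apply coprime_mul.
        -- apply Ha'; [exact Hj|]. intros H; apply Sj; lia.
        -- apply Hcop; try lia. intros ->. apply Sj; [lia|exact Sk].
    + exists a. split.
      * intros i Hi Si. apply Ha; [|exact Si].
        destruct (Nat.eq_dec i k) as [->|Hne]; [contradiction|lia].
      * intros j Hj Sj. apply Ha'; [exact Hj|]. intros H; apply Sj; lia. }
destruct (Hprod n (le_n n)) as [a [Ha Ha']].
exists a, (fact n). intros i Hi. split.
(* A modulus dividing [a] and coprime to [a] would be 1, but [n! > 0] makes it larger. *)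
- intros Hd. change (Nat.divide (m i) a) in Hd. apply NNPP. intros Si.
  specialize (Ha' i Hi (fun _ => Si)).
  rewrite (proj1 (Nat.divide_gcd_iff _ _) Hd) in Ha'.
  unfold m in Ha'. pose proof (lt_O_fact n). nia.
- intros Si. now apply Ha.
Qed.

(** * The leftmost branch *)

Section LeftmostBranch.

(** [good N P] abstracts [D(N)]. Antitonicity merges two requirements into one at the larger [N];
    locality lets finite codes stand in for arbitrary sets. *)
Variable good : nat -> (nat -> Prop) -> Prop.
Hypothesis good_antitone : forall N N' P, N <= N' -> good N' P -> good N P.
Hypothesis good_local : forall N, exists n, forall P Q : nat -> Prop,
  (forall i, i < n -> (P i <-> Q i)) -> good N P -> good N Q.

(* The string [S(0) ... S(i-1) 0] is extendible. *)
Definition extends_by_zero (i : nat) (S : nat -> Prop) : Prop :=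
  forall N, exists a b, (forall j, j < i -> (S j <-> coded a b j)) /\
    ~ coded a b i /\ good N (coded a b).

(** The recursion for the branch, put as a condition on a code of an initial segment: recursion thus
    becomes quantification over codes. *)
Definition leftmost_code (n a b : nat) : Prop :=
  forall i, i < n -> (coded a b i <-> ~ extends_by_zero i (coded a b)).

Definition leftmost (n : nat) : Prop :=
  exists a b, leftmost_code (n + 1) a b /\ coded a b n.

Lemma extends_by_zero_ext (i : nat) (S T : nat -> Prop) :
  (forall j, j < i -> (S j <-> T j)) ->
  extends_by_zero i S -> extends_by_zero i T.
Proof.
intros HST HS N. destruct (HS N) as (a & b & Hj & H).
exists a, b. split; [|exact H].
intros j Hji. rewrite <- (HST j Hji). now apply Hj.
Qed.

(** One value is appended at a time. The whole segment is recoded for this, and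
    [extends_by_zero_ext] carries the earlier conditions over to the new code. *)
Lemma leftmost_code_exists (n : nat) : exists a b, leftmost_code n a b.
Proof.
induction n as [|n (a & b & IH)].
- exists 0, 0. intros i Hi. lia.
- destruct (coded_finite
    (fun i => (i < n /\ coded a b i) \/ (i = n /\ ~ extends_by_zero n (coded a b)))
    (S n)) as (a' & b' & Hab).
  assert (Hlt : forall i, i < n -> (coded a b i <-> coded a' b' i)).
  { intros i Hi. rewrite (Hab i) by lia. split; [tauto|].
    intros [[_ H]|[-> _]]; [exact H|lia]. }
  assert (Hext : forall i, i <= n ->
    (extends_by_zero i (coded a b) <-> extends_by_zero i (coded a' b'))).
  { intros i Hi. split; apply extends_by_zero_ext; intros j Hj.
    - apply Hlt; lia.
    - symmetry; apply Hlt; lia. }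
  exists a', b'. intros i Hi. rewrite <- Hext by lia.
  destruct (Nat.eq_dec i n) as [->|Hne].
  + rewrite (Hab n) by lia. split; [|tauto].
    intros [[H _]|[_ H]]; [lia|exact H].
  + rewrite <- Hlt by lia. apply IH; lia.
Qed.

(** Strong induction on [i]: the values below [i] decide [extends_by_zero i], hence the value at
    [i]. *)
Lemma leftmost_code_unique (n n' a b a' b' i : nat) :
  leftmost_code n a b -> leftmost_code n' a' b' -> i < n -> i < n' ->
  (coded a b i <-> coded a' b' i).
Proof.
intros H H'. induction i as [i IH] using lt_wf_ind. intros Hi Hi'.
rewrite (H i Hi), (H' i Hi').
split; intros Hn Hx; apply Hn; revert Hx; apply extends_by_zero_ext;
  intros j Hj; [symmetry|]; apply IH; lia.
Qed.

Lemma leftmost_coded (n a b i : nat) :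
  leftmost_code n a b -> i < n -> (leftmost i <-> coded a b i).
Proof.
intros H Hi. split.
- intros (a' & b' & H' & Hc).
  now apply (leftmost_code_unique H' H); [lia|..].
- intros Hc. exists a, b. split; [|exact Hc].
  intros j Hj. apply H; lia.
Qed.

Lemma leftmost_iff (i : nat) : leftmost i <-> ~ extends_by_zero i leftmost.
Proof.
destruct (leftmost_code_exists (S i)) as (a & b & H).
rewrite (leftmost_coded H) by lia. rewrite (H i) by lia.
split; intros Hn Hx; apply Hn; revert Hx; apply extends_by_zero_ext;
  intros j Hj; [|symmetry]; apply (leftmost_coded H); lia.
Qed.

(** The invariant of the greedy choice: each initial segment extends for every [N]. If 0 cannot be
    appended, some [N0] refutes it, and a code good at both [N] and [N0] must contain [n]. *)
Lemma leftmost_extendible (P : nat -> Prop) (n : nat) :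
  (forall N, good N P) ->
  forall N, exists a b,
    (forall j, j < n -> (leftmost j <-> coded a b j)) /\ good N (coded a b).
Proof.
intros HP. induction n as [|n IH]; intros N.
(* The given solution [P] is cut off at the locality bound and coded. *)
- destruct (good_local N) as [l Hl].
  destruct (coded_finite P l) as (a & b & Hab).
  exists a, b. split; [lia|].
  apply (Hl P); [|apply HP]. intros i Hi. symmetry. now apply Hab.
- destruct (classic (extends_by_zero n leftmost)) as [H|H].
  + destruct (H N) as (a & b & Hj & Hn & Hg).
    exists a, b. split; [|exact Hg]. intros j Hj'.
    destruct (Nat.eq_dec j n) as [->|Hne]; [|apply Hj; lia].
    rewrite (leftmost_iff n). tauto.
  + destruct (not_all_ex_not _ _ H) as [N0 HN0].
    destruct (IH (Nat.max N N0)) as (a & b & Hj & Hg).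
    exists a, b. split; [|apply (good_antitone (Nat.le_max_l N N0) Hg)].
    intros j Hj'. destruct (Nat.eq_dec j n) as [->|Hne]; [|apply Hj; lia].
    rewrite (leftmost_iff n). split; [|intros _; exact H].
    intros _. apply NNPP. intros Hc. apply HN0. exists a, b.
    split; [exact Hj|]. split; [exact Hc|].
    apply (good_antitone (Nat.le_max_r N N0) Hg).
Qed.

(** Only the values below the locality bound of [N] matter, and there [leftmost] agrees with a good
    code. *)
Lemma leftmost_good (P : nat -> Prop) :
  (forall N, good N P) -> forall N, good N leftmost.
Proof.
intros HP N. destruct (good_local N) as [l Hl].
destruct (leftmost_extendible l HP N) as (a & b & Hj & Hg).
apply (Hl (coded a b)); [|exact Hg].
intros i Hi. symmetry. now apply Hj.
Qed.

End LeftmostBranch.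

(** * Syntax *)

Lemma eval_below (n : nat) (t : term) (e e' : nat -> nat) :
  term_below n t -> (forall i, i < n -> e i = e' i) -> eval e t = eval e' t.
Proof.
intros Ht He. induction t; simpl in *; auto.
- rewrite IHt1, IHt2; tauto.
- rewrite IHt1, IHt2; tauto.
Qed.

Lemma scons_agree (n x : nat) (e e' : nat -> nat) :
  (forall i, i < n -> e i = e' i) ->
  forall i, i < S n -> scons x e i = scons x e' i.
Proof.
intros He [|i] Hi; simpl; [reflexivity|]. apply He; lia.
Qed.

Lemma sat_below (Sym : Type) (I : Sym -> nat -> Prop) (f : formula Sym)
    (n : nat) (e e' : nat -> nat) : formula_below n f ->
  (forall i, i < n -> e i = e' i) -> (sat I e f <-> sat I e' f).
Proof.
revert n e e'.
induction f as [t u|t u|s t|f IH|f IHf g IHg|f IHf g IHg|f IHf g IHg|f IH|f IH];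
  simpl; intros n e e' Hf He.
- destruct Hf as [Ht Hu].
  rewrite (eval_below Ht He), (eval_below Hu He). tauto.
- destruct Hf as [Ht Hu].
  rewrite (eval_below Ht He), (eval_below Hu He). tauto.
- rewrite (eval_below Hf He). tauto.
- rewrite (IH n e e') by assumption. tauto.
- destruct Hf. rewrite (IHf n e e'), (IHg n e e') by assumption. tauto.
- destruct Hf. rewrite (IHf n e e'), (IHg n e e') by assumption. tauto.
- destruct Hf. rewrite (IHf n e e'), (IHg n e e') by assumption. tauto.
- split; intros H x; apply (IH (S n) (scons x e) (scons x e'));
    auto; now apply scons_agree.
- split; intros [x H]; exists x; apply (IH (S n) (scons x e) (scons x e'));
    auto; now apply scons_agree.
Qed.

Lemma eval_shift (x : nat) (e : nat -> nat) (t : term) :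
  eval (scons x e) (shift t) = eval e t.
Proof. induction t; simpl; auto. Qed.

(** * Locality of [Delta0] formulas *)

Lemma bounded_choice (Q : nat -> nat -> Prop) (b : nat) :
  (forall y n n', n <= n' -> Q y n -> Q y n') ->
  (forall y, exists n, Q y n) -> exists n, forall y, y < b -> Q y n.
Proof.
intros Hmono Hex. induction b as [|b [n Hn]].
- exists 0. lia.
- destruct (Hex b) as [n' Hn']. exists (Nat.max n n'). intros y Hy.
  destruct (Nat.eq_dec y b) as [->|Hne].
  + apply Hmono with n'; [lia|exact Hn'].
  + apply Hmono with n; [lia|]. apply Hn; lia.
Qed.

(** An atom reads a symbol at one value, a connective takes the maximum of two bounds, and a bounded
    quantifier has finitely many instances, whose bounds [bounded_choice] unites. *)
Lemma Delta0_local (Sym : Type) (f : formula Sym) : Delta0 f ->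
  forall e, exists n, forall P Q : Sym -> nat -> Prop,
    (forall s i, i < n -> (P s i <-> Q s i)) -> (sat P e f <-> sat Q e f).
Proof.
assert (Hbin : forall (f g : formula Sym) (e : nat -> nat),
  (exists n, forall P Q : Sym -> nat -> Prop,
    (forall s i, i < n -> (P s i <-> Q s i)) -> (sat P e f <-> sat Q e f)) ->
  (exists n, forall P Q : Sym -> nat -> Prop,
    (forall s i, i < n -> (P s i <-> Q s i)) -> (sat P e g <-> sat Q e g)) ->
  exists n, forall P Q : Sym -> nat -> Prop,
    (forall s i, i < n -> (P s i <-> Q s i)) ->
    (sat P e f <-> sat Q e f) /\ (sat P e g <-> sat Q e g)).
{ intros g h e [n Hn] [m Hm]. exists (Nat.max n m). intros P Q HPQ.
  split; [apply Hn|apply Hm]; intros s i Hi; apply HPQ; lia. }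
assert (Hbd : forall (f : formula Sym) (e : nat -> nat) (t : term),
  (forall e, exists n, forall P Q : Sym -> nat -> Prop,
    (forall s i, i < n -> (P s i <-> Q s i)) -> (sat P e f <-> sat Q e f)) ->
  exists n, forall y, y < eval e t -> forall P Q : Sym -> nat -> Prop,
    (forall s i, i < n -> (P s i <-> Q s i)) ->
    (sat P (scons y e) f <-> sat Q (scons y e) f)).
{ intros g e t Hg. apply bounded_choice.
  - intros y n n' Hnn H P Q HPQ. apply H. intros s i Hi. apply HPQ; lia.
  - intros y. apply Hg. }
induction 1 as [t u|t u|s t|f _ IH|f g _ IHf _ IHg|f g _ IHf _ IHg
               |f g _ IHf _ IHg|t f _ IH|t f _ IH]; intros e; simpl.
- exists 0. tauto.
- exists 0. tauto.
- exists (S (eval e t)). intros P Q HPQ. apply HPQ. lia.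
- destruct (IH e) as [n Hn]. exists n. intros P Q HPQ. now rewrite (Hn P Q).
- destruct (Hbin _ _ _ (IHf e) (IHg e)) as [n Hn]. exists n.
  intros P Q HPQ. destruct (Hn P Q HPQ). tauto.
- destruct (Hbin _ _ _ (IHf e) (IHg e)) as [n Hn]. exists n.
  intros P Q HPQ. destruct (Hn P Q HPQ). tauto.
- destruct (Hbin _ _ _ (IHf e) (IHg e)) as [n Hn]. exists n.
  intros P Q HPQ. destruct (Hn P Q HPQ). tauto.
- destruct (Hbd f e t IH) as [n Hn]. exists n. intros P Q HPQ.
  split; intros H y Hy; specialize (H y Hy); rewrite eval_shift in Hy;
    now apply (Hn y Hy P Q HPQ).
- destruct (Hbd f e t IH) as [n Hn]. exists n. intros P Q HPQ.
  split; intros [y [Hy H]]; exists y; (split; [exact Hy|]);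
    rewrite eval_shift in Hy; now apply (Hn y Hy P Q HPQ).
Qed.

(** * Numerals and elimination of parameters *)

Definition numeral (c : nat) : term := Nat.iter c (tAdd tOne) tZero.

Lemma eval_numeral (c : nat) (e : nat -> nat) : eval e (numeral c) = c.
Proof. induction c; simpl; auto. Qed.

Lemma shift_numeral (c : nat) : shift (numeral c) = numeral c.
Proof.
induction c as [|c IH]; [reflexivity|].
change (tAdd tOne (shift (numeral c)) = tAdd tOne (numeral c)). now rewrite IH.
Qed.

Lemma numeral_below (n c : nat) : term_below n (numeral c).
Proof. induction c; simpl; auto. Qed.

Fixpoint close_term (p : nat) (e : nat -> nat) (t : term) : term :=
  match t with
  | tVar i => if i <? p then tVar i else numeral (e i)
  | tZero => tZero
  | tOne => tOne
  | tAdd t u => tAdd (close_term p e t) (close_term p e u)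
  | tMul t u => tMul (close_term p e t) (close_term p e u)
  end.

(** Free variables from [p] on become numerals. The 0 put on the environment under a quantifier is a
    dummy: index 0 lies below [S p] and is never looked up. *)
Fixpoint close (Sym : Type) (p : nat) (e : nat -> nat) (f : formula Sym)
    : formula Sym :=
  match f with
  | fEq t u => fEq (close_term p e t) (close_term p e u)
  | fLt t u => fLt (close_term p e t) (close_term p e u)
  | fRel s t => fRel s (close_term p e t)
  | fNot g => fNot (close p e g)
  | fAnd g h => fAnd (close p e g) (close p e h)
  | fOr g h => fOr (close p e g) (close p e h)
  | fImp g h => fImp (close p e g) (close p e h)
  | fAll g => fAll (close (S p) (scons 0 e) g)
  | fEx g => fEx (close (S p) (scons 0 e) g)
  end.

Lemma close_term_below (p : nat) (e : nat -> nat) (t : term) :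
  term_below p (close_term p e t).
Proof.
induction t as [i| | | |]; simpl; auto.
destruct (Nat.ltb_spec i p); [exact H|apply numeral_below].
Qed.

Lemma close_below (Sym : Type) (f : formula Sym) :
  forall (p : nat) (e : nat -> nat), formula_below p (close p e f).
Proof.
induction f; simpl; auto using close_term_below.
Qed.

Lemma eval_close (p : nat) (e E E' : nat -> nat) (t : term) :
  (forall i, E' i = if i <? p then E i else e i) ->
  eval E (close_term p e t) = eval E' t.
Proof.
intros HE. induction t as [i| | | |]; simpl; auto.
rewrite HE. destruct (i <? p); [reflexivity|apply eval_numeral].
Qed.

Lemma sat_close (Sym : Type) (I : Sym -> nat -> Prop) (f : formula Sym) :
  forall (p : nat) (e E E' : nat -> nat),
  (forall i, E' i = if i <? p then E i else e i) ->
  (sat I E (close p e f) <-> sat I E' f).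
Proof.
assert (Hscons : forall p e E E' x,
  (forall i, E' i = if i <? p then E i else e i) ->
  forall i, scons x E' i = if i <? S p then scons x E i else scons 0 e i).
{ intros p e E E' x HE [|i]; [reflexivity|apply HE]. }
induction f as [t u|t u|s t|f IH|f IHf g IHg|f IHf g IHg|f IHf g IHg|f IH|f IH];
  simpl; intros p e E E' HE.
- rewrite !(eval_close _ HE). tauto.
- rewrite !(eval_close _ HE). tauto.
- rewrite !(eval_close _ HE). tauto.
- rewrite (IH p e E E') by assumption. tauto.
- rewrite (IHf p e E E'), (IHg p e E E') by assumption. tauto.
- rewrite (IHf p e E E'), (IHg p e E E') by assumption. tauto.
- rewrite (IHf p e E E'), (IHg p e E E') by assumption. tauto.
- split; intros H x; specialize (H x); revert H; apply IH; auto.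
- split; intros [x H]; exists x; revert H; apply IH; auto.
Qed.

(** Keeps the bound of a bounded quantifier in the shape [shift t], so that [close] preserves
    [Delta0]. *)
Lemma close_term_shift (p x : nat) (e : nat -> nat) (t : term) :
  close_term (S p) (scons x e) (shift t) = shift (close_term p e t).
Proof.
induction t as [i| | |t IHt u IHu|t IHt u IHu]; simpl; auto.
- change (S i <? S p) with (i <? p).
  destruct (i <? p); simpl; [reflexivity|]. now rewrite shift_numeral.
- now rewrite IHt, IHu.
- now rewrite IHt, IHu.
Qed.

Lemma close_Delta0 (Sym : Type) (f : formula Sym) : Delta0 f ->
  forall p e, Delta0 (close p e f).
Proof.
induction 1; intros p e; simpl; try (constructor; auto; fail).
- rewrite close_term_shift. apply D0_all, IHDelta0.
- rewrite close_term_shift. apply D0_ex, IHDelta0.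
Qed.

Lemma close_iter_all (Sym : Type) (k : nat) (f : formula Sym) :
  forall (p : nat) (e : nat -> nat), exists e',
  close p e (Nat.iter k (@fAll Sym) f) = Nat.iter k (@fAll Sym) (close (k + p) e' f).
Proof.
induction k as [|k IH]; intros p e; simpl; [now exists e|].
destruct (IH (S p) (scons 0 e)) as [e' He'].
exists e'. now rewrite He', Nat.add_succ_r.
Qed.

(** * Bounding a block of universal quantifiers *)

(* The bounding variable has index [p] outside the [k] quantifiers. *)
Fixpoint bounded_all (Sym : Type) (k p : nat) (f : formula Sym) : formula Sym :=
  match k with
  | 0 => f
  | S k => fAll (fImp (fLt (tVar 0) (shift (tVar p))) (bounded_all k (S p) f))
  end.

Lemma bounded_all_Delta0 (Sym : Type) (k : nat) (f : formula Sym) :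
  Delta0 f -> forall p, Delta0 (bounded_all k p f).
Proof.
intros Hf. induction k as [|k IH]; intros p; simpl; [exact Hf|].
apply (D0_all (tVar p)), IH.
Qed.

Lemma formula_below_weaken (Sym : Type) (f : formula Sym) :
  forall n n', n <= n' -> formula_below n f -> formula_below n' f.
Proof.
assert (Ht : forall t n n', n <= n' -> term_below n t -> term_below n' t).
{ induction t; simpl; intros m m' Hm; try lia; intuition eauto. }
induction f; simpl; intros m m' Hm; try (intuition eauto; fail).
- apply IHf; lia.
- apply IHf; lia.
Qed.

Lemma bounded_all_below (Sym : Type) (k : nat) (f : formula Sym) :
  forall p, formula_below (k + p) f -> formula_below (S p) (bounded_all k p f).
Proof.
induction k as [|k IH]; intros p Hf; simpl.
- apply formula_below_weaken with p; [lia|exact Hf].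
- split; [lia|]. apply IH. now rewrite Nat.add_succ_r.
Qed.

(** Variable [p] serves only as the common bound of the block, so lowering it weakens the
    condition. *)
Lemma bounded_all_antitone (Sym : Type) (I : Sym -> nat -> Prop) (k : nat)
    (f : formula Sym) :
  forall (p : nat) (e e' : nat -> nat), formula_below (k + p) f ->
  (forall i, i < p -> e i = e' i) -> e p <= e' p ->
  sat I e' (bounded_all k p f) -> sat I e (bounded_all k p f).
Proof.
induction k as [|k IH]; intros p e e' Hf He Hp; simpl.
- now apply (sat_below I Hf).
- intros H y Hy. apply (IH (S p) _ (scons y e')).
  + now rewrite Nat.add_succ_r.
  + now apply scons_agree.
  + exact Hp.
  + apply H. lia.
Qed.

(** Every tuple lies below some common bound, so the unbounded block amounts to all its bounded
    versions. The bound is the value [e' p], which is left arbitrary. *)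
Lemma sat_iter_all (Sym : Type) (I : Sym -> nat -> Prop) (k : nat)
    (f : formula Sym) :
  forall (p : nat) (e : nat -> nat), formula_below (k + p) f ->
  (sat I e (Nat.iter k (@fAll Sym) f) <->
   forall e', (forall i, i < p -> e' i = e i) -> sat I e' (bounded_all k p f)).
Proof.
induction k as [|k IH]; intros p e Hf; simpl.
- split.
  + intros H e' He. now apply (sat_below I Hf He).
  + intros H. now apply H.
- rewrite Nat.add_succ_comm in Hf. split.
  + intros H e' He y _. apply (proj1 (IH (S p) (scons y e) Hf) (H y)).
    now apply scons_agree.
  + intros H y. apply (IH (S p)); [exact Hf|]. intros e' He'.
    (* Drop the entry for [y] from [e'] and raise the bound above [y], so that [H] applies at [y];
       antitonicity then returns to the bound [e' (S p)]. *)
    set (e'' := fun i => if i =? p then Nat.max (S y) (e' (S p)) else e' (S i)).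
    assert (Hp : e'' p = Nat.max (S y) (e' (S p))).
    { unfold e''. now rewrite Nat.eqb_refl. }
    assert (Hlt : forall i, i < p -> e'' i = e' (S i)).
    { intros i Hi. unfold e''. now rewrite (proj2 (Nat.eqb_neq i p)) by lia. }
    apply bounded_all_antitone with (scons y e''); [exact Hf| | |].
    * intros [|i] Hi; simpl.
      -- apply (He' 0 Hi).
      -- rewrite Hlt; [reflexivity|lia].
    * simpl. lia.
    * apply H; [|lia]. intros i Hi. rewrite Hlt by exact Hi.
      apply (He' (S i)). lia.
Qed.

(** * Arithmetical definability of the leftmost branch *)

(** Parameters are numbers, so numerals replace them; only variable 0, the candidate element, is
    kept. *)
Lemma arith_definable_with_parameters (A : nat -> Prop) (f : formula Empty_set)
    (e : nat -> nat) :
  (forall n, A n <-> sat no_symbols (scons n e) f) -> arith_definable A.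
Proof.
intros HA. exists (close 1 (scons 0 e) f). split; [apply close_below|].
intros n e'. rewrite HA. symmetry. apply sat_close. now intros [|i].
Qed.

Definition fIff (Sym : Type) (f g : formula Sym) : formula Sym :=
  fAnd (fImp f g) (fImp g f).

Definition fCoded (Sym : Type) (a b t : term) : formula Sym :=
  fEx (fEq (shift a)
    (tMul (tVar 0) (tAdd tOne (tMul (tAdd (shift t) tOne) (shift b))))).

Arguments fCoded {Sym} _ _ _.

Lemma sat_coded (Sym : Type) (I : Sym -> nat -> Prop) (e : nat -> nat)
    (a b t : term) :
  sat I e (fCoded a b t) <-> coded (eval e a) (eval e b) (eval e t).
Proof.
simpl. unfold coded, Nat.divide.
split; intros [q H]; exists q; rewrite !eval_shift in *; exact H.
Qed.

(** Lets an arithmetical formula speak of satisfaction by a finite set given through its code. *)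
Fixpoint interpret_coded (a b : term) (f : formula unit) : formula Empty_set :=
  match f with
  | fEq t u => fEq t u
  | fLt t u => fLt t u
  | fRel _ t => fCoded a b t
  | fNot g => fNot (interpret_coded a b g)
  | fAnd g h => fAnd (interpret_coded a b g) (interpret_coded a b h)
  | fOr g h => fOr (interpret_coded a b g) (interpret_coded a b h)
  | fImp g h => fImp (interpret_coded a b g) (interpret_coded a b h)
  | fAll g => fAll (interpret_coded (shift a) (shift b) g)
  | fEx g => fEx (interpret_coded (shift a) (shift b) g)
  end.

Lemma sat_interpret_coded (f : formula unit) :
  forall (a b : term) (e : nat -> nat),
  sat no_symbols e (interpret_coded a b f) <->
  sat (fun _ => coded (eval e a) (eval e b)) e f.
Proof.
induction f as [t u|t u|s t|f IH|f IHf g IHg|f IHf g IHg|f IHf g IHg|f IH|f IH];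
  intros a b e; cbn [interpret_coded sat].
- tauto.
- tauto.
- apply sat_coded.
- rewrite IH. tauto.
- rewrite IHf, IHg. tauto.
- rewrite IHf, IHg. tauto.
- rewrite IHf, IHg. tauto.
- split; intros H x; specialize (H x); apply IH in H || apply IH;
    now rewrite !eval_shift in *.
- split; intros [x H]; exists x; apply IH in H || apply IH;
    now rewrite !eval_shift in *.
Qed.

Section LeftmostFormula.

Variable D : formula unit.
Hypothesis D_below : formula_below 1 D.

(** This is [D(N)]. Since [D] has at most variable 0 free, the constant environment is as good as
    any with [N] in front. *)
Definition satisfies_upto (N : nat) (P : nat -> Prop) : Prop :=
  sat (fun _ => P) (fun _ => N) D.

(* Environment [i :: b :: a :: _]; the innermost quantifier moves [N] to index 0,
   where [D] expects it. *)
Definition fExtends_by_zero : formula Empty_set :=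
  fAll (fEx (fEx (fAnd
    (fAll (fImp (fLt (tVar 0) (tVar 4))
      (fIff (fCoded (tVar 6) (tVar 5) (tVar 0)) (fCoded (tVar 2) (tVar 1) (tVar 0)))))
    (fAnd (fNot (fCoded (tVar 1) (tVar 0) (tVar 3)))
      (fEx (fAnd (fEq (tVar 0) (tVar 3)) (interpret_coded (tVar 2) (tVar 1) D))))))).

Lemma sat_extends_by_zero (i a b : nat) (e : nat -> nat) :
  sat no_symbols (scons i (scons b (scons a e))) fExtends_by_zero <->
  extends_by_zero satisfies_upto i (coded a b).
Proof.
assert (HD : forall N P E, E 0 = N ->
  (sat (fun _ => P) E D <-> satisfies_upto N P)).
{ intros N P E HE. apply (sat_below _ D_below).
  intros j Hj. now replace j with 0 by lia. }
unfold fExtends_by_zero, extends_by_zero, fIff.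
cbn [sat]. setoid_rewrite sat_coded. setoid_rewrite sat_interpret_coded.
cbn [eval scons].
split; intros H N; destruct (H N) as (a' & b' & Hj & Hn & Hg);
  exists a', b'; (split; [intros j Hji; specialize (Hj j Hji); tauto|]);
  (split; [exact Hn|]).
- destruct Hg as (N' & -> & Hg). revert Hg. now apply HD.
- exists N. split; [reflexivity|]. revert Hg. now apply HD.
Qed.

Lemma leftmost_definable : arith_definable (leftmost satisfies_upto).
Proof.
(* Under the bounded quantifier the environment is [i :: b :: a :: n :: _], in the order that
   [fExtends_by_zero] expects. *)
apply arith_definable_with_parameters with (e := fun _ => 0) (f :=
  fEx (fEx (fAnd
    (fAll (fImp (fLt (tVar 0) (tAdd (tVar 3) tOne))
      (fIff (fCoded (tVar 2) (tVar 1) (tVar 0)) (fNot fExtends_by_zero))))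
    (fCoded (tVar 1) (tVar 0) (tVar 2))))).
intros n. unfold leftmost, leftmost_code, fIff.
cbn [sat]. setoid_rewrite sat_coded. setoid_rewrite sat_extends_by_zero.
cbn [eval scons].
split; intros (a & b & Hi & Hn); exists a, b; (split; [|exact Hn]);
  intros i Hin; specialize (Hi i Hin); tauto.
Qed.

End LeftmostFormula.

(** * From [Pi1] conditions with parameters to [Sigma2] sentences *)

Lemma Pi1_arith_definable_model (k : nat) (d : formula unit) (e : nat -> nat)
    (P : nat -> Prop) :
  Delta0 d -> sat (fun _ => P) e (Nat.iter k (@fAll unit) d) ->
  exists A, arith_definable A /\ sat (fun _ => A) e (Nat.iter k (@fAll unit) d).
Proof.
intros Hd HP.
destruct (close_iter_all k d 0 e) as [e' Hclose].
set (d' := close (k + 0) e' d) in Hclose.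
set (D := bounded_all k 0 d').
assert (Hd' : formula_below (k + 0) d') by apply close_below.
assert (HD : formula_below 1 D) by now apply bounded_all_below.
(* The form [forall N, D(N)]: parameters in [e] have become numerals and [N] bounds the whole
   block. *)
assert (Hiff : forall Q, sat (fun _ => Q) e (Nat.iter k (@fAll unit) d) <->
  forall N, satisfies_upto D N Q).
{ intros Q.
  rewrite <- (@sat_close _ (fun _ => Q) (Nat.iter k (@fAll unit) d) 0 e e e)
    by reflexivity.
  rewrite Hclose, (sat_iter_all (fun _ => Q) e Hd'). split.
  - intros H N. apply H. lia.
  - intros H e'' _. apply (sat_below (e := fun _ => e'' 0) _ HD); [|apply H].
    intros i Hi. now replace i with 0 by lia. }
exists (leftmost (satisfies_upto D)). split; [now apply leftmost_definable|].
apply Hiff. apply leftmost_good with P.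
- intros N N' Q HN. now apply bounded_all_antitone; [|lia|].
- intros N.
  destruct (Delta0_local (bounded_all_Delta0 k (close_Delta0 Hd (k + 0) e') 0)
    (fun _ => N)) as [n Hn].
  exists n. intros Q R HQR. apply (Hn (fun _ => Q) (fun _ => R)). intros _. exact HQR.
- now apply Hiff.
Qed.

(** The witnesses are numbers, so those found for [I] remain available for any [J] that satisfies
    the matrix at them. *)
Lemma sat_iter_ex (Sym : Type) (I : Sym -> nat -> Prop) (m : nat)
    (f : formula Sym) : forall e, sat I e (Nat.iter m (@fEx Sym) f) ->
  exists e', sat I e' f /\
    forall J, sat J e' f -> sat J e (Nat.iter m (@fEx Sym) f).
Proof.
induction m as [|m IH]; intros e; simpl; [now exists e|].
intros [x Hx]. destruct (IH _ Hx) as (e' & He' & H).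
exists e'. split; [exact He'|]. intros J HJ. exists x. auto.
Qed.

Theorem mainTheorem4 (alpha : formula unit)
    (hsent : sentence alpha)
    (hsigma : Sigma2 alpha)
    (hmodel : has_standard_model alpha) :
  exists A : nat -> Prop,
    arith_definable A /\ models (fun _ : unit => A) alpha.
Proof.
destruct hsigma as (m & k & d & Hd & Halpha).
destruct hmodel as [I HI].
assert (HP : sat (fun _ => I tt) (fun _ => 0) alpha).
{ replace (fun _ : unit => I tt) with I; [apply HI|].
  apply functional_extensionality. now intros []. }
rewrite Halpha in HP. destruct (sat_iter_ex HP) as (e & He & Hex).
destruct (Pi1_arith_definable_model Hd He) as (A & HA & Hsat).
exists A. split; [exact HA|]. intros e'.
apply (sat_below (e := fun _ => 0) _ hsent); [lia|].
rewrite Halpha. now apply Hex.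
Qed.
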